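(* For every integer $k \ge 2$, one has $G(1) < G(k)$, where for an integer $k \ge 1$ $$G(k) = \frac{1}{\varphi(2k)} \sum_{d \in (\mathbb{Z}/2k\mathbb{Z})^\times} \left( \frac{\gcd(d-1,2k) - 1}{(\log_2 (2k))^2} \right)^{-1/2}.$$
   Context: $\varphi$ is Euler's totient function and $\log_2$ is the logarithm to base $2$. For a residue class $d \in (\mathbb{Z}/2k\mathbb{Z})^\times$, $\gcd(d-1,2k)$ is computed with any integer representative of $d$ (with $\gcd(0,2k)=2k$); since units modulo $2k$ are odd, this gcd is always at least $2$. The function $G(k)$ is the case $M = 1$ of $$G(k_1,\dots,k_M) = \frac{1}{\varphi(\ell)} \sum_{d \in (\mathbb{Z}/\ell\mathbb{Z})^\times} \left( \sum_{i=1}^M \frac{\gcd(d-1,2k_i)-1}{(\log_2 (2k_i))^2} \right)^{-1/2}, \qquad \ell = \operatorname{lcm}\{2k_i : 1 \le i \le M\}.$$ *)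

(* Defs.v *)
(* MathComp world, with MathComp-Analysis for the reals. *)
From mathcomp Require Import all_boot all_order all_fingroup all_algebra.
From mathcomp Require Import all_classical all_reals all_analysis.

Set Implicit Arguments.
Unset Strict Implicit.
Unset Printing Implicit Defensive.

Import Order.TTheory GRing.Theory Num.Theory.
Local Open Scope ring_scope.

Definition log2 (R : realType) (x : R) : R := ln x / ln 2.

(* gcd(d - 1, n) for a residue class d modulo n, computed in int with the
   representative of d in {0, ..., n - 1}; any other representative gives the
   same value, and d = 1 gives gcd(0, n) = n. Meaningful for 1 < n only, since
   'Z_0 and 'Z_1 both denote the integers modulo 2. *)
Definition gcd_pred (n : nat) (d : 'Z_n) : int :=
  gcdz ((d : nat)%:Z - 1) n%:Z.

(* Meaningful for 1 <= k. *)
Definition G (R : realType) (k : nat) : R :=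
  (totient (2 * k)%N)%:R^-1 *
  \sum_(d : {unit 'Z_(2 * k)})
    (((gcd_pred (val d))%:~R - 1) / log2 (2 * k)%N%:R ^+ 2) `^ (- 2^-1).

(* Main.v *)
Require Import Defs.
From mathcomp Require Import all_boot all_order all_fingroup all_algebra.
From mathcomp Require Import all_classical all_reals all_analysis.
From mathcomp Require Import zify ring lra.

Import Order.TTheory GRing.Theory Num.Theory.

(** Put n = 2k. Since G(1) = 1, the claim is that log2 n times the mean of
    (gcd(d - 1, n) - 1)^(-1/2) over the units d modulo n exceeds 1. With
    y = d - 1 the mean runs over the y < n such that y + 1 is prime to n
    ([G_eq]); discard all of them but those with gcd(y, n) equal to 2 or 4,
    which contribute 1 and 1/sqrt 3 >= 1/2 each ([sum_shift_gcd_ge]).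

    Write n = 2^a m with m odd, and let r be the number of primes dividing m.
    A y in a suitable residue class modulo a power of 2 has gcd(y, n) = 2 (or
    4) as soon as y and y + 1 are both prime to m. By the Chinese remainder
    theorem these y are counted by S(m) = #{y < m : y (y + 1) prime to m},
    Schemmel's totient [schemmel], which is multiplicative with
    S(p^e) = p^(e-1) (p - 2). Hence, relative to phi(n), the retained terms
    contribute at least S(m) / phi(m) when a = 1 and (5/8) S(m) / phi(m) when
    a >= 2.

    The ratio S(m) / phi(m) is the product of (p - 2) / (p - 1) over the primes
    p dividing m. The i-th of them is at least 2i + 1, so the ratio is at least
    the product of (2i - 1) / (2i) for i <= r, which decays only like
    r^(-1/2), whereas log2 n >= a + 3r/2 because m >= 3^r and 9 >= 8. The
    product of the two therefore grows with r. The bound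
    S(m) / phi(m) >= 7 / (2 (3r + 4)) of [totient_le_schemmel] is chosen to be
    inductive in r and still to leave a margin: it gives G(k) >= 35/28 when
    a = 1 (then r >= 1, as n >= 4) and G(k) >= 35/32 when a >= 2. *)

(** * Sums of periodic functions *)

Lemma sum_nat_crt (A B : nat) (u v : nat -> nat) :
  0 < A -> 0 < B -> coprime A B ->
  \sum_(0 <= x < A * B) u (x %% A) * v (x %% B) =
  (\sum_(0 <= i < A) u i) * (\sum_(0 <= j < B) v j).
Proof.
move=> A0 B0 coAB; rewrite big_distrlr /= !big_mkord.
under [RHS]eq_bigr do rewrite big_mkord.
rewrite pair_bigA /=.
have AB0 : 0 < A * B by rewrite muln_gt0 A0.
pose f (x : 'I_(A * B)) : 'I_A * 'I_B :=
  (Ordinal (ltn_pmod x A0), Ordinal (ltn_pmod x B0)).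
have finj : injective f.
  move=> x y [/= eA eB]; apply/val_inj => /=.
  have /eqP : x == y %[mod A * B] by rewrite chinese_remainder // eA eB !eqxx.
  by rewrite !modn_small.
have fbij : bijective f.
  by apply: inj_card_bij => //; rewrite card_prod !card_ord.
by rewrite (reindex f) //; apply: onW_bij.
Qed.

Lemma sum_nat_periodic (A q : nat) (u : nat -> nat) :
  \sum_(0 <= x < q * A) u (x %% A) = q * \sum_(0 <= x < A) u x.
Proof.
rewrite big_nat_mul (eq_bigr (fun=> \sum_(0 <= x < A) u x)) => [|i _].
  by rewrite sum_nat_const_nat subn0.
rewrite mulSn -{1}[i * A]add0n big_addn addnK !big_nat.
by apply: eq_bigr => j /andP[_ jA]; rewrite addnC modnMDl modn_small.
Qed.

Lemma sum_residue_class (c M q : nat) : c < M ->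
  \sum_(0 <= y < q * M) (y %% M == c : nat) = q.
Proof.
move=> cM; rewrite (sum_nat_periodic M q (fun x => x == c : nat)).
by rewrite big_mkord -[c]/(val (Ordinal cM)) -big_mkcond sum1_card card1 muln1.
Qed.

(** * Schemmel's totient *)

(** Here y stands for d - 1: the product y (y + 1) depends on y modulo m only,
    whereas d (d - 1) would involve a truncated subtraction at d = 0. *)
Definition coprime_consecutive (m y : nat) : bool := coprime m (y * y.+1).

Definition schemmel (m : nat) : nat := \sum_(0 <= y < m) coprime_consecutive m y.

Lemma coprime_consecutive_mod (m y d : nat) : d %| m ->
  coprime_consecutive d (y %% m) = coprime_consecutive d y.
Proof.
move=> dm; rewrite /coprime_consecutive -[LHS]coprime_modr -[RHS]coprime_modr.
by rewrite -modnMm -addn1 -modnDml !modn_dvdm // modnDml modnMm addn1.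
Qed.

Lemma schemmelM (m n : nat) : 0 < m -> 0 < n -> coprime m n ->
  schemmel (m * n) = schemmel m * schemmel n.
Proof.
move=> m0 n0 co; rewrite -sum_nat_crt //; apply: eq_bigr => y _.
by rewrite !coprime_consecutive_mod // mulnb -coprimeMl.
Qed.

(** Modulo p, exactly the two residues 0 and -1 are excluded. *)
Lemma schemmel_pfactor (p e : nat) : prime p -> 0 < e ->
  schemmel (p ^ e) = (p - 2) * p ^ e.-1.
Proof.
move=> p_pr; case: e => // e _ /=; have p1 := prime_gt1 p_pr.
rewrite mulnC expnSr -[p - 2](_ : \sum_(0 <= y < p) coprime_consecutive p y = _).
  rewrite -sum_nat_periodic; apply: eq_bigr => y _.
  rewrite coprime_consecutive_mod // /coprime_consecutive -expnSr.
  by rewrite coprime_pexpl.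
case: p p1 p_pr => [|[|p]] // _ p_pr; rewrite big_nat_recr //= big_nat_recl //=.
rewrite [X in _ + X](_ : _ = 0); last first.
  by rewrite /coprime_consecutive coprimeMr /coprime gcdnn /= andbF.
rewrite addn0 add0n big_nat (eq_bigr (fun=> 1)) => [|y /andP[_ yp]].
  by rewrite -big_nat sum_nat_const_nat subn0 muln1 !subSS subn0.
rewrite /coprime_consecutive coprimeMr !prime_coprime // !gtnNdvd //.
by rewrite ltnS (leq_trans yp).
Qed.

(** The primes dividing m are distinct odd numbers at least 3, so halving maps
    them injectively into [1, q / 2], where q is the largest of them. *)
Lemma size_primes_max_pdiv (m : nat) : odd m ->
  (size (primes m)).*2 < max_pdiv m.
Proof.
move=> m_odd; set q := max_pdiv m.
have odd_pr p : p \in primes m -> odd p.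
  by rewrite mem_primes => /and3P[_ _ pm]; apply: dvdn_odd pm m_odd.
have sub : {subset map half (primes m) <= iota 1 q./2}.
  move=> _ /mapP[p pm ->]; rewrite mem_iota add1n ltnS half_leq ?max_pdiv_max //.
  by have := pm; rewrite mem_primes => /and3P[/prime_gt1 + _ _]; case: (p) => [|[]].
have u : uniq (map half (primes m)).
  rewrite map_inj_in_uniq ?primes_uniq // => x y /odd_pr ox /odd_pr oy exy.
  by rewrite -(odd_double_half x) -(odd_double_half y) ox oy exy.
have := uniq_leq_size u sub; rewrite size_map size_iota.
have q_odd : odd q by apply: dvdn_odd (max_pdiv_dvd m) m_odd.
by rewrite -{2}(odd_double_half q) q_odd add1n ltnS leq_double.
Qed.

(** Removing the full power of the largest prime q from m divides S / phi by
    (q - 2) / (q - 1), and q > 2r makes this factor at least (2r - 1) / (2r).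
    The induction then reduces to
    (2r - 1) / (2r) >= (3r + 1) / (3r + 4), which holds for r >= 2. *)
Lemma totient_le_schemmel (m : nat) : odd m ->
  7 * totient m <= 2 * (3 * size (primes m) + 4) * schemmel m.
Proof.
have [n] := ubnP m; elim: n m => // n IHn m /ltnSE le_mn m_odd.
have [m_le1 | m_gt1] := leqP m 1.
  have -> : m = 1 by case: m m_odd m_le1 {le_mn} => [|[]].
  by rewrite /schemmel big_nat1.
have m_gt0 := ltnW m_gt1.
have q_pr := max_pdiv_prime m_gt1; have := size_primes_max_pdiv _ m_odd.
set q := max_pdiv m in q_pr *; set r := size _ => r_lt_q.
have e_gt0 : 0 < logn q m by rewrite logn_gt0 -/(q \in \pi(m)) pi_max_pdiv.
have co : coprime m`_q m`_q^' by rewrite coprime_partC.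
have mE : m = m`_q * m`_q^' by rewrite partnC.
set m' := m`_q^' in co mE.
have m'_gt0 : 0 < m' by rewrite part_gt0.
have m'_odd : odd m' by move: m_odd; rewrite mE oddM => /andP[].
have rE : r = (size (primes m')).+1.
  rewrite /r /m' primes_part size_filter.
  rewrite -(count_predC (pred1 q) (primes m)) addnC.
  by rewrite count_uniq_mem ?primes_uniq // pi_max_pdiv m_gt1 addn1.
have lt_m' : m' < m.
  rewrite mE p_part -{1}[m']mul1n ltn_pmul2r // -(exp1n (logn q m)).
  by rewrite ltn_exp2r ?prime_gt1.
have tE : totient m = q ^ (logn q m).-1 * (q.-1 * totient m').
  by rewrite {1}mE totient_coprime // p_part totient_pfactor // mulnAC mulnC.
have sE : schemmel m = q ^ (logn q m).-1 * ((q - 2) * schemmel m').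
  rewrite {1}mE schemmelM ?part_gt0 // p_part schemmel_pfactor //.
  by rewrite mulnAC mulnC.
rewrite {}tE {}sE ![_ * (q ^ _ * _)]mulnCA leq_mul2l; apply/orP; right.
(* The step r' -> r' + 1 with the extremal prime q = 2 r' + 3 holds exactly
   when 3 r' >= 1, so m' = 1 is treated on its own. *)
case: (posnP (size (primes m'))) => [s0|s_gt0].
  have -> : m' = 1.
    apply/eqP; move: s0 => /size0nil/eqP; rewrite primes_eq0; lia.
  rewrite /schemmel big_nat1 [coprime_consecutive _ _]isT -[totient 1]/1 rE s0.
  by move: r_lt_q; rewrite rE s0; clear; lia.
have := IHn m' (leq_trans lt_m' le_mn) m'_odd.
rewrite {}rE in r_lt_q *.
move: (size _) (schemmel _) (totient _) s_gt0 r_lt_q => s S T s_gt0 s_lt_q IH.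
have qE : q = (2 * s + 3 + (q - (2 * s + 3))) by lia.
move: (q - _) qE => u ->.
have -> : (2 * s + 3 + u).-1 = 2 * s + 2 + u by lia.
have -> : 2 * s + 3 + u - 2 = 2 * s + 1 + u by lia.
rewrite mulnCA [leqRHS]mulnCA.
have h : (2 * s + 2 + u) * (2 * (3 * s + 4)) <=
         (2 * s + 1 + u) * (2 * (3 * s.+1 + 4)).
  by clear -s_gt0; nia.
apply: leq_trans (leq_mul (leqnn _) IH) _.
by rewrite mulnA [leqRHS]mulnA leq_mul2r h orbT.
Qed.

Lemma expn3_size_primes (m : nat) : odd m -> 3 ^ size (primes m) <= m.
Proof.
move=> m_odd; have m_gt0 := odd_gt0 m_odd.
rewrite {2}(prod_prime_decomp m_gt0) prime_decompE big_map /=.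
rewrite -sum1_size expn_sum !big_seq; apply: leq_prod => p p_m.
have p_ge3 : 3 <= p.
  have := p_m; rewrite mem_primes => /and3P[p_pr _ p_dvd].
  by rewrite odd_prime_gt2 // (dvdn_odd p_dvd).
rewrite expn1 (leq_trans p_ge3) // -{1}[p]expn1 leq_pexp2l //.
  exact: leq_trans p_ge3.
by rewrite logn_gt0.
Qed.

(** A form of log2 (2^a m) >= a + 3r/2 within the natural numbers: each prime of
    m contributes a factor at least 3 to m, and 3^2 >= 2^3. *)
Lemma expn2_le_sqr (a m : nat) : odd m ->
  2 ^ (2 * a + 3 * size (primes m)) <= (2 ^ a * m) ^ 2.
Proof.
move=> m_odd; rewrite expnD expnMn -expnM [a * 2]mulnC.
rewrite leq_mul2l; apply/orP; right.
apply: leq_trans (_ : (3 ^ size (primes m)) ^ 2 <= _).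
  rewrite -expnM [_ * 2]mulnC !expnM; case: (size _) => // r.
  by rewrite leq_exp2r.
by rewrite leq_sqr expn3_size_primes.
Qed.

(** * Residues whose gcd with the modulus is 2 or 4 *)

(** For n > 1 this is the number of units d modulo n with gcd(d - 1, n) = g,
    through d = y + 1. *)
Definition count_shift_gcd (n g : nat) : nat :=
  \sum_(0 <= y < n | coprime n y.+1 && (gcdn y n == g)) 1.

Lemma sum_residue_class_coprime_consecutive (a b c m : nat) :
  odd m -> b <= a -> c < 2 ^ b ->
  \sum_(0 <= y < 2 ^ a * m | y %% 2 ^ b == c) coprime_consecutive m y =
  2 ^ (a - b) * schemmel m.
Proof.
move=> m_odd ba cb; have m_gt0 := odd_gt0 m_odd.
have co : coprime (2 ^ a) m by rewrite coprimeXl // coprime2n.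
rewrite -(@sum_residue_class c (2 ^ b) (2 ^ (a - b))) // -expnD subnK //.
rewrite -sum_nat_crt ?expn_gt0 // big_mkcond; apply: eq_bigr => y _.
rewrite modn_dvdm ?dvdn_exp2l // coprime_consecutive_mod //.
by case: eqP; rewrite ?mul1n ?mul0n.
Qed.

(** If gcd(y, 2^a) = g > 1, then y is even and y + 1 is odd. So the conditions at
    2 hold on the whole residue class of c modulo 2^b, and the conditions at the
    odd primes are exactly those counted by Schemmel's totient. *)
Lemma count_shift_gcd_ge (a b c g m : nat) :
  odd m -> b <= a -> c < 2 ^ b -> 1 < g ->
  (forall y, y %% 2 ^ b = c -> gcdn y (2 ^ a) = g) ->
  2 ^ (a - b) * schemmel m <= count_shift_gcd (2 ^ a * m) g.
Proof.
move=> m_odd ba cb g_gt1 gE.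
rewrite -(@sum_residue_class_coprime_consecutive a b c) //.
rewrite /count_shift_gcd big_mkcond [leqRHS]big_mkcond /=; apply: leq_sum => y _.
case: eqP => // /gE gy; case: (boolP (coprime_consecutive m y)) => //.
rewrite /coprime_consecutive coprimeMr => /andP[co_y co_y1].
have -> : gcdn y (2 ^ a * m) = g by rewrite Gauss_gcdl // coprime_sym.
rewrite eqxx andbT coprimeMl co_y1 andbT.
case: a {gE ba} gy => [_|a gy]; first by rewrite expn0 coprime1n.
rewrite coprime_pexpl // coprime2n /=.
have : g %| 2 ^ a.+1 by rewrite -gy dvdn_gcdr.
case/(dvdn_pfactor _ _ (isT : prime 2)) => -[|j] _ gj.
  by rewrite gj in g_gt1.
have : 2 %| y.
  by rewrite (dvdn_trans _ (dvdn_gcdl y (2 ^ a.+1))) // gy gj dvdn_exp.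
by rewrite dvdn2 => ->.
Qed.

Lemma gcdn_exp2 (j a y : nat) :
  j < a -> y %% 2 ^ j.+1 = 2 ^ j -> gcdn y (2 ^ a) = 2 ^ j.
Proof.
move=> ja e; have -> : y = 2 ^ j * (y %/ 2 ^ j.+1).*2.+1.
  by rewrite {1}(divn_eq y (2 ^ j.+1)) e expnS -mul2n; ring.
rewrite -(subnKC (ltnW ja)) expnD -muln_gcdr -[RHS]muln1; congr (_ * _).
apply/eqP; rewrite -[_ == _]/(coprime _ _) coprimeXr //.
by rewrite coprimen2 /= odd_double.
Qed.

Lemma gcdn_exp2_dvd (a y : nat) : y %% 2 ^ a = 0 -> gcdn y (2 ^ a) = 2 ^ a.
Proof. by move=> /eqP; apply: gcdn_idPr. Qed.

Lemma count_shift_gcd2_twice_odd (m : nat) : odd m ->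
  schemmel m <= count_shift_gcd (2 * m) 2.
Proof.
move=> m_odd.
have := @count_shift_gcd_ge 1 1 0 2 m m_odd isT isT isT (@gcdn_exp2_dvd 1).
by rewrite mul1n.
Qed.

Lemma count_shift_gcd2 (a m : nat) : odd m -> 1 < a ->
  2 ^ (a - 2) * schemmel m <= count_shift_gcd (2 ^ a * m) 2.
Proof.
move=> m_odd a_gt1; apply: (@count_shift_gcd_ge a 2 2) => // y.
exact: (@gcdn_exp2 1).
Qed.

(** When a = 2 the class is 0 modulo 4, a quarter of all residues; when a >= 3 it
    is 4 modulo 8, an eighth. The factor 2 covers the latter case. *)
Lemma count_shift_gcd4 (a m : nat) : odd m -> 1 < a ->
  2 ^ (a - 2) * schemmel m <= 2 * count_shift_gcd (2 ^ a * m) 4.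
Proof.
move=> m_odd a_gt1; have [a_le2 | a_gt2] := leqP a 2.
  have -> : a = 2 by lia.
  have := @count_shift_gcd_ge 2 2 0 4 m m_odd isT isT isT (@gcdn_exp2_dvd 2).
  by rewrite subnn mul1n; lia.
have -> : a - 2 = (a - 3).+1 by lia.
rewrite expnS -mulnA leq_mul2l /=; apply: (@count_shift_gcd_ge a 3 4) => // y.
exact: (@gcdn_exp2 2).
Qed.

(** * G as a sum over natural numbers *)

Local Open Scope ring_scope.

(** The representative 0 of 'Z_n and the shifted index n - 1 (for d = n) are both
    non-units, so shifting the range of summation by one changes nothing. *)
Lemma sum_units_Zp (R : realType) (n : nat) (F : nat -> R) : (1 < n)%N ->
  \sum_(d : {unit 'Z_n}) F (val d : 'Z_n) =
  \sum_(0 <= y < n | coprime n y.+1) F y.+1.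
Proof.
case: n => [|[|n]] // n_gt1.
transitivity (\sum_(d : 'Z_n.+2 | d \is a GRing.unit) F d).
  rewrite (reindex_omap (val : {unit 'Z_n.+2} -> 'Z_n.+2) insub) => [|d d_unit].
    by apply: eq_bigl => d; rewrite valK eqxx andbT (valP d).
  by rewrite insubT.
have unitE (d : 'Z_n.+2) : (d \is a GRing.unit) = coprime n.+2 d.
  by rewrite -unitZpE // natr_Zp.
rewrite (eq_bigl (fun d : 'I_n.+2 => coprime n.+2 d)) //.
rewrite -(big_mkord (fun d => coprime n.+2 d) F) big_mkcond big_nat_recl //=.
rewrite add0r [RHS]big_mkcond [RHS]big_nat_recr //=.
by rewrite [coprime _ _](_ : _ = false) ?addr0 // /coprime gcdnn.
Qed.

Lemma powR_gcd_shift (R : realType) (n y : nat) : (0 < n)%N ->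
  (((gcdz (y.+1%:Z - 1) n%:Z)%:~R - 1) / log2 (n%:R : R) ^+ 2) `^ (- 2^-1) =
  log2 (n%:R : R) / Num.sqrt (gcdn y n).-1%:R.
Proof.
move=> n_gt0; rewrite -addn1 PoszD addrK /gcdz !absz_nat.
have g_gt0 : (0 < gcdn y n)%N by rewrite gcdn_gt0 n_gt0 orbT.
have L_ge0 : 0 <= log2 (n%:R : R) by rewrite divr_ge0 // ln_ge0 // ler1n.
rewrite -[X in X - 1]/(_%:R) -{1}(prednK g_gt0) -natr1 addrK.
rewrite powRN powR12_sqrt ?divr_ge0 ?sqr_ge0 // sqrtrM // sqrtrV ?sqr_ge0 //.
by rewrite sqrtr_sqr ger0_norm // invfM invrK mulrC.
Qed.

Lemma G_eq (R : realType) (k : nat) : (0 < k)%N ->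
  G R k = log2 ((2 * k)%:R : R) / (totient (2 * k))%:R *
    \sum_(0 <= y < 2 * k | coprime (2 * k) y.+1)
      (Num.sqrt (gcdn y (2 * k)).-1%:R)^-1.
Proof.
move=> k_gt0; have n_gt1 : (1 < 2 * k)%N by lia.
pose F (d : nat) : R := (((gcdz (d%:Z - 1) (2 * k)%N%:Z)%:~R - 1) /
  log2 ((2 * k)%:R : R) ^+ 2) `^ (- 2^-1).
rewrite /G [X in _ * X](sum_units_Zp R (2 * k) F) //.
rewrite [log2 _ / _]mulrC -mulrA; congr (_ * _); rewrite mulr_sumr.
by apply: eq_bigr => y _; apply/powR_gcd_shift/ltnW.
Qed.

Lemma log2_2 (R : realType) : log2 (2 : R) = 1.
Proof. by rewrite /log2 divff // lt0r_neq0 // ln_gt0 // ltr1n. Qed.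

Lemma G1 (R : realType) : G R 1 = 1.
Proof.
rewrite G_eq // muln1 log2_2 -[totient 2]/1%N invr1 !mul1r.
by rewrite big_mkcond !big_nat_recr //= big_nil sqrtr1 invr1 add0r addr0.
Qed.

(** * Lower bounds for the two factors of G *)

Lemma log2_ge (R : realType) (p q n : nat) : (0 < n)%N ->
  (2 ^ p <= n ^ q)%N -> p%:R <= q%:R * log2 (n%:R : R).
Proof.
move=> n_gt0 le_pn; have ln2_gt0 : 0 < ln (2 : R) by rewrite ln_gt0 // ltr1n.
rewrite mulrA ler_pdivlMr // !mulr_natl -!lnXn ?ltr0n //.
rewrite ler_ln ?posrE ?exprn_gt0 ?ltr0n //.
by rewrite -!natrX ler_nat.
Qed.

Lemma sum_shift_gcd_ge (R : realType) (n : nat) :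
  (count_shift_gcd n 2)%:R + (count_shift_gcd n 4)%:R / 2 <=
  \sum_(0 <= y < n | coprime n y.+1) (Num.sqrt (gcdn y n).-1%:R)^-1 :> R.
Proof.
have inv_ge0 y : 0 <= (Num.sqrt (gcdn y n).-1%:R)^-1 :> R.
  by rewrite invr_ge0 sqrtr_ge0.
rewrite (bigID (fun y => gcdn y n == 2)%N) /=; apply: lerD.
  rewrite /count_shift_gcd natr_sum; apply: ler_sum => y /andP[_ /eqP ->].
  by rewrite sqrtr1 invr1.
rewrite (bigID (fun y => gcdn y n == 4)%N) /= -[leLHS]addr0.
apply: lerD; last by apply: sumr_ge0.
rewrite /count_shift_gcd natr_sum mulr_suml.
rewrite [leRHS](eq_bigl
  (fun y => coprime n y.+1 && (gcdn y n == 4)%N)) => [|y]; last first.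
  by case: (gcdn y n =P 4) => [->|]; rewrite ?andbT ?andbF.
apply: ler_sum => y /andP[_ /eqP ->].
(* sqrt 3 <= 2 *)
rewrite mul1r lef_pV2 ?posrE ?sqrtr_gt0 ?ltr0n //.
by rewrite -[leRHS]ger0_norm // -sqrtr_sqr ler_sqrt ?sqr_ge0 // -natrX ler_nat.
Qed.

(** The arithmetic for a = A >= 2, with X = 2^(a-2), S and T the values at m of
    Schemmel's and Euler's totients, L = log2 n, r the number of primes
    dividing m, N2 and N4 the numbers of retained residues, and W the sum over all residues. *)
Lemma lt_mul_of_two_classes (R : realFieldType) (X S T r A L N2 N4 W : R) :
  7 * T <= 2 * (3 * r + 4) * S ->
  2 * A + 3 * r <= 2 * L -> N2 + N4 / 2 <= W -> X * S <= N2 -> X * S <= 2 * N4 ->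
  0 < X -> 0 < S -> 0 <= r -> 2 <= A -> 2 * X * T < L * W.
Proof.
move=> key LE WE N2E N4E X_gt0 S_gt0 r_ge0 A_ge2.
have rS_ge0 : 0 <= r * S by rewrite mulr_ge0 // ltW.
have TS : 2 * T < (2 + 3 / 2 * r) * (5 / 4 * S) by lra.
have XS_gt0 : 0 < X * S by rewrite mulr_gt0.
have W_ge : 5 / 4 * (X * S) <= W by lra.
apply: lt_le_trans (_ : X * ((2 + 3 / 2 * r) * (5 / 4 * S)) <= _).
  by rewrite [ltLHS](_ : _ = X * (2 * T)) ?ltr_pM2l //; ring.
rewrite mulrCA [X * (_ * S)]mulrCA; apply: ler_pM => //; lra.
Qed.

(** The arithmetic for a = 1, in the same notation. *)
Lemma lt_mul_of_one_class (R : realFieldType) (S T r L N2 N4 W : R) :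
  7 * T <= 2 * (3 * r + 4) * S ->
  2 + 3 * r <= 2 * L -> N2 + N4 / 2 <= W -> S <= N2 -> 0 <= N4 ->
  0 < S -> 1 <= r -> T < L * W.
Proof.
move=> key LE WE N2E N4E S_gt0 r_ge1.
have rS_ge : S <= r * S by rewrite ler_peMl // ltW.
apply: lt_le_trans (_ : (1 + 3 / 2 * r) * S <= _); first by lra.
apply: ler_pM; lra.
Qed.

Theorem theorem2 (R : realType) (k : nat) (hk : (2 <= k)%N) : G R 1 < G R k.
Proof.
have k_gt0 : (0 < k)%N by apply: ltnW.
rewrite G1 G_eq //.
have [a [m [a_gt0 m_odd nE]]] :
    exists a m, [/\ 0 < a, odd m & 2 * k = 2 ^ a * m]%N.
  have [m m_odd kE] := pfactor_coprime (isT : prime 2) k_gt0.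
  exists (logn 2 k).+1, m; split=> //; first by rewrite -coprime2n.
  by rewrite {1}kE expnS -mulnA [(m * _)%N]mulnC.
set L := log2 _; set W := \sum_(_ <= _ < _ | _) _.
have LE : (2 * a + 3 * size (primes m))%:R <= 2 * L.
  by apply: log2_ge; rewrite ?muln_gt0 //= nE expn2_le_sqr.
have WE : (count_shift_gcd (2 * k) 2)%:R +
          (count_shift_gcd (2 * k) 4)%:R / 2 <= W.
  exact: sum_shift_gcd_ge.
have T_gt0 : (0 < totient m)%N by rewrite totient_gt0 odd_gt0.
have TE : totient (2 * k) = (2 ^ a.-1 * totient m)%N.
  rewrite nE totient_coprime ?coprimeXl ?coprime2n //.
  by rewrite totient_pfactor // mul1n.
have key := totient_le_schemmel _ m_odd.
rewrite mulrAC ltr_pdivlMr ?ltr0n ?TE ?muln_gt0 ?expn_gt0 // mul1r.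
have S_gt0 : (0 < schemmel m)%N by nia.
move: key LE; rewrite -(ler_nat R) natrD !natrM natrD natrM => key LE.
case: (ltnP 1 a) => a_gt1.
  have -> : a.-1 = (a - 2).+1 by lia.
  rewrite expnS !natrM.
  apply: (lt_mul_of_two_classes _ _ _ _ _ _ _ _ _ _ key LE WE);
    rewrite ?ltr0n ?ler0n ?expn_gt0 ?ler_nat //.
    by rewrite -natrM ler_nat nE count_shift_gcd2.
  by rewrite -!natrM ler_nat nE count_shift_gcd4.
have aE : a = 1%N by lia.
rewrite aE mul1r; apply: (lt_mul_of_one_class _ _ _ _ _ _ _ _ key _ WE) => //.
- by move: LE; rewrite aE mulr1.
- by rewrite ler_nat nE aE count_shift_gcd2_twice_odd.
- by rewrite ltr0n.
rewrite ler1n lt0n size_eq0 primes_eq0 -leqNgt.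
by move: nE hk; rewrite aE; clear; lia.
Qed.
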